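(* For $i\ge 0$ let $l_i=2^{2\cdot 2^i+4}$, $m_i=2^{8\cdot 2^i}$, $n_i=2^{10\cdot 2^i}$. Define finite words over $\{0,1\}$ by $u_0=0$, $v_0=1$ and, for all $i\ge 0$, $u_{i+1}=u_i^{m_i}v_i^{l_i}$ and $v_{i+1}=u_i^{m_i}v_i^{n_i}$, and let $u$ be the infinite word having every $u_i$ as a prefix. Then the complexity function $\mathbf{p}$ of $u$ satisfies $$\liminf_{n\to\infty}\frac{\mathbf{p}(n)}{n}=2.$$
   Context: $w^n$ is the concatenation of $n$ copies of the finite word $w$. The complexity function of an infinite word $u$ is $\mathbf{p}(n)=$ the number of distinct factors (finite blocks of consecutive letters) of $u$ of length $n$. *)

(* Defs.v *)
From mathcomp Require Import all_boot all_order all_algebra.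
From mathcomp Require Import all_classical all_reals all_analysis.

Set Implicit Arguments.
Unset Strict Implicit.
Unset Printing Implicit Defensive.

Definition wpow (T : Type) (w : seq T) (n : nat) : seq T := flatten (nseq n w).

(* An infinite word over T is a function nat -> T. *)
Definition block (T : Type) (x : nat -> T) (k n : nat) : seq T :=
  mkseq (fun j => x (k + j)) n.

Definition prefix_of (T : Type) (w : seq T) (x : nat -> T) : Prop :=
  block x 0 (size w) = w.

Definition factor_of (T : Type) (w : seq T) (x : nat -> T) : Prop :=
  exists k : nat, block x k (size w) = w.

Definition complexity (T : finType) (x : nat -> T) (n : nat) : nat :=
  #|[set w : n.-tuple T | `[< factor_of w x >] ]|.

Definition l_ (i : nat) : nat := 2 ^ (2 * 2 ^ i + 4).
Definition m_ (i : nat) : nat := 2 ^ (8 * 2 ^ i).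
Definition n_ (i : nat) : nat := 2 ^ (10 * 2 ^ i).

(* The letters 0 and 1 are false and true; uv i is the pair (u_i, v_i). *)
Fixpoint uv (i : nat) : seq bool * seq bool :=
  if i is j.+1 then
    (wpow (uv j).1 (m_ j) ++ wpow (uv j).2 (l_ j),
     wpow (uv j).1 (m_ j) ++ wpow (uv j).2 (n_ j))
  else ([:: false], [:: true]).

Definition u_ (i : nat) : seq bool := (uv i).1.
Definition v_ (i : nat) : seq bool := (uv i).2.

Lemma u_S (i : nat) : u_ i.+1 = wpow (u_ i) (m_ i) ++ wpow (v_ i) (l_ i).
Proof. by []. Qed.

Lemma v_S (i : nat) : v_ i.+1 = wpow (u_ i) (m_ i) ++ wpow (v_ i) (n_ i).
Proof. by []. Qed.

Lemma u_S_cat (i : nat) :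
  exists s, u_ i.+1 = u_ i ++ s /\ (size (v_ i) <= size s)%N.
Proof.
rewrite u_S.
have -> : m_ i = (m_ i).-1.+1 by rewrite prednK // expn_gt0.
have -> : l_ i = (l_ i).-1.+1 by rewrite prednK // expn_gt0.
rewrite /wpow /= -catA; eexists; split; first by [].
by rewrite !size_cat addnCA leq_addr.
Qed.

Lemma size_v_gt0 (i : nat) : (0 < size (v_ i))%N.
Proof.
elim: i => // i IHi; rewrite v_S size_cat.
have -> : n_ i = (n_ i).-1.+1 by rewrite prednK // expn_gt0.
by rewrite [wpow (v_ i) _]/= size_cat addnCA ltn_addr.
Qed.

Lemma size_u_gt (i : nat) : (i < size (u_ i))%N.
Proof.
elim: i => // i IHi; have [s [-> le_vs]] := u_S_cat i.
have := leq_add IHi (leq_trans (size_v_gt0 i) le_vs).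
by rewrite size_cat addn1.
Qed.

Lemma nth_u_ (i j k : nat) : (i <= j)%N -> (k < size (u_ i))%N ->
  nth false (u_ j) k = nth false (u_ i) k.
Proof.
move=> /subnK <-; elim: (j - i) => // d IHd lt_k.
have [s [-> _]] := u_S_cat (d + i); rewrite nth_cat IHd //.
case: ifP => // /negP []; apply: leq_trans lt_k _.
elim: d {IHd} => // d IHd; have [t [-> _]] := u_S_cat (d + i).
by rewrite size_cat (leq_trans IHd) // leq_addr.
Qed.

Lemma exists_unique_limit_word :
  exists! u : nat -> bool, forall i : nat, prefix_of (u_ i) u.
Proof.
exists (fun k => nth false (u_ k) k); split=> [i|y Hy].
  apply: (@eq_from_nth _ false); rewrite ?size_mkseq // => k lt_k.
  rewrite nth_mkseq // add0n; case: (leqP i k) => [le_ik|/ltnW le_ki].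
    by rewrite (nth_u_ le_ik).
  by rewrite (nth_u_ le_ki) // size_u_gt.
apply/funext => k.
by rewrite -[in LHS](Hy k) nth_mkseq // size_u_gt.
Qed.

(* Main.v *)
Require Import Defs.
From mathcomp Require Import all_boot all_order all_algebra.
From mathcomp Require Import all_classical all_reals all_analysis.
From mathcomp Require Import zify ring.

Set Implicit Arguments.
Unset Strict Implicit.
Unset Printing Implicit Defensive.

(** Let P_i = u_i ... u_1 be the longest common prefix of the continuations of
    u_i and of v_i, and S_i = v_0^(l_0) ... v_(i-1)^(l_(i-1)) the longest
    common suffix of u_i and v_i: P_i is followed by 0 in u_i... and by 1 in
    v_i..., S_i is preceded by 0 in u_i and by 1 in v_i. Hence
    A_i = S_i u_i^(m_i - 1) P_i and B_i = S_i v_i^(n_i - 1) P_i are right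
    special. The common suffix of A_i and B_i is S_i P_i, that of B_i and
    A_(i+1) is S_i v_i^(l_i) P_i, and the ranges of lengths in which these
    pairs have distinct suffixes cover all n >= 1. So there are always two
    right special words of length n, p(n+1) >= p(n) + 2, and p(n) >= 2 n.

    Conversely, a factor of length N = l_i |v_i| meets at most one change
    between a run of u_i and a run of v_i, so it lies in u_i^(m_i) v_i^(n_i) or
    in v_i^(n_i) u_i^(m_i); by periodicity p(N) <= 2 (N + |u_i| + |v_i|), and
    |v_i| / N = 1 / l_i tends to 0. *)

(** * Powers of words and blocks *)

Section Words.
Variable T : Type.
Implicit Types (w x y : seq T) (X : nat -> T).

Lemma wpowD w a b : wpow w (a + b) = wpow w a ++ wpow w b.
Proof. by rewrite /wpow nseqD flatten_cat. Qed.

Lemma wpow1 w : wpow w 1 = w.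
Proof. exact: cats0. Qed.

Lemma wpowS w a : wpow w a.+1 = w ++ wpow w a.
Proof. by []. Qed.

Lemma wpowSr w a : wpow w a.+1 = wpow w a ++ w.
Proof. by rewrite -addn1 wpowD wpow1. Qed.

Lemma size_wpow w a : size (wpow w a) = a * size w.
Proof. by elim: a => // a IHa; rewrite wpowS size_cat IHa mulSn. Qed.

Lemma nth_wpow (x0 : T) w a t :
  t < a * size w -> nth x0 (wpow w a) t = nth x0 w (t %% size w).
Proof.
elim: a t => [|a IHa] t; first by rewrite mul0n.
rewrite wpowS nth_cat mulSn => lt_t; have [lt_tw|le_t] := ltnP t (size w).
  by rewrite modn_small.
by rewrite IHa ?ltn_subLR // -[in RHS](subnK le_t) modnDr.
Qed.

Lemma take_drop_wpow w a q r N : q * size w + r + N <= a * size w ->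
  take N (drop (q * size w + r) (wpow w a)) = take N (drop r (wpow w a)).
Proof.
move=> le_a; have sz k : k + N <= a * size w ->
    size (take N (drop k (wpow w a))) = N.
  by move=> ?; rewrite size_takel // size_drop size_wpow; lia.
case: w le_a sz => [|x0 w] le_a sz; first by rewrite muln0.
apply: (@eq_from_nth _ x0) => [|t]; rewrite !sz //; try lia.
move=> lt_t; rewrite !nth_take // !nth_drop !nth_wpow; try lia.
by rewrite -addnA modnMDl.
Qed.

Lemma take_drop_catl n k x y :
  k + n <= size x -> take n (drop k (x ++ y)) = take n (drop k x).
Proof.
move=> le_k; rewrite drop_cat; case: ltnP => ?.
  by rewrite takel_cat // size_drop; lia.
by have -> : n = 0 by [lia]; rewrite !take0.
Qed.

Lemma drop_catl k x y : k <= size x -> drop k (x ++ y) = drop k x ++ y.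
Proof.
rewrite leq_eqVlt drop_cat => /predU1P[->|->//].
by rewrite ltnn subnn drop0 drop_size.
Qed.

Lemma drop_catr k x y : size x <= k -> drop k (x ++ y) = drop (k - size x) y.
Proof. by move=> le_xk; rewrite drop_cat ltnNge le_xk. Qed.

Lemma blockD X k a b : block X k (a + b) = block X k a ++ block X (k + a) b.
Proof.
rewrite /block /mkseq iotaD map_cat add0n -[X in iota X b]addn0 iotaDl.
rewrite -map_comp.
by congr (_ ++ _); apply: eq_map => j /=; rewrite addnA.
Qed.

Lemma blockS X k n : block X k n.+1 = rcons (block X k n) (X (k + n)).
Proof. exact: mkseqS. Qed.

End Words.

(** * Infixes of concatenations *)

Section Infixes.
Variable T : eqType.
Implicit Types (w x y z : seq T) (X : nat -> T).

Lemma infix_takeP (w x : seq T) :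
  reflect (exists2 k, k + size w <= size x & take (size w) (drop k x) = w)
          (infix w x).
Proof.
apply: (iffP (@infixP _ w x)) => [[p [s ->]]|[k le_k <-]].
  by exists (size p); rewrite ?drop_size_cat ?take_size_cat // !size_cat; lia.
by exists (take k x), (drop (size w) (drop k x)); rewrite !cat_take_drop.
Qed.

(** An occurrence of [w] meeting both [x] and [z] would cover [y] and at least two more letters. *)
Lemma infix_cat3 w x y z : size w <= size y ->
  infix w (x ++ y ++ z) -> infix w (x ++ y) \/ infix w (y ++ z).
Proof.
move=> le_wy /infix_takeP[k le_k def_w].
have [le_kxy|lt_xyk] := leqP (k + size w) (size (x ++ y)).
  left; apply/infix_takeP; exists k => //.
  by rewrite catA take_drop_catl in def_w.
move: le_k lt_xyk; rewrite !size_cat => le_k lt_xyk.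
right; apply/infix_takeP; exists (k - size x); first by rewrite size_cat; lia.
by rewrite drop_catr in def_w => //; lia.
Qed.

Lemma infix_cat_suffix_prefix w x y s p :
  suffix s x -> prefix p y -> infix (s ++ w ++ p) (x ++ w ++ y).
Proof.
move=> /suffixP[s' ->] /prefixP[p' ->]; apply/infixP; exists s', p'.
by rewrite -!catA.
Qed.

Lemma infix_flatten w (ss : seq (seq T)) : 0 < size w ->
  {in ss, forall y, size w <= size y} -> infix w (flatten ss) ->
  exists y z, [/\ y \in ss, z \in ss & infix w (y ++ z)].
Proof.
move=> w_gt0; elim: ss => [|y [|z ss] IH] le_w.
- by rewrite infixs0 => /eqP w0; rewrite w0 in w_gt0.
- rewrite /flatten [foldr _ _ _]/= cats0 => wy.
  by exists y, y; rewrite mem_head infix_catr.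
case/infix_cat3 => [|wyz|]; first by rewrite le_w // !inE eqxx orbT.
  by exists y, z; rewrite !inE !eqxx orbT.
case/IH => [t tzs|t [t' [tzs t'zs wtt']]].
  by rewrite le_w // inE tzs orbT.
by exists t, t'; split=> //; rewrite inE ?tzs ?t'zs orbT.
Qed.

(* The other windows of x^a y^b are periodic shifts of these, whose starting
   positions run from N + |x| before the transition to |y| after it; if the
   truncated subtraction vanishes, they start at 0 and nothing is lost. *)
Definition transition_windows x y a b N :=
  [seq take N (drop k (wpow x a ++ wpow y b))
     | k <- iota (a * size x - N - size x) (N + size x + size y)].

Lemma mem_transition_windows x y a b w : 0 < size x -> 0 < size y ->
  infix w (wpow x a ++ wpow y b) -> w \in transition_windows x y a b (size w).
Proof.
move=> x_gt0 y_gt0 /infix_takeP[k]; rewrite size_cat !size_wpow => le_k def_w.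
set e := a * size x in le_k *.
suff [k' /andP[le_k' lt_k'] def_k'] : exists2 k',
    e - size w - size x <= k' < e - size w - size x + (size w + size x + size y)
    & take (size w) (drop k (wpow x a ++ wpow y b)) =
      take (size w) (drop k' (wpow x a ++ wpow y b)).
  by apply/mapP; exists k'; rewrite ?mem_iota ?le_k' // -def_k'.
have [le_ek|lt_ke] := leqP e k.
  exists (e + (k - e) %% size y).
    by have := ltn_pmod (k - e) y_gt0; lia.
  rewrite !drop_catr ?size_wpow -/e ?leq_addr // addKn.
  by rewrite {1}(divn_eq (k - e) (size y)) take_drop_wpow // -divn_eq; lia.
have [?|lt_k] := leqP (e - size w - size x) k; first by exists k => //; lia.
(* A window that starts too early moves right by [q] periods; it then ends less than [size x]
   letters before the end of [wpow x a]. *)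
set q := (e - size w - k) %/ size x.
have := divn_eq (e - size w - k) (size x); rewrite -/q => def_q.
have := ltn_pmod (e - size w - k) x_gt0 => lt_mod.
exists (q * size x + k); first by lia.
have [? ?] : k + size w <= e /\ q * size x + k + size w <= e by lia.
by rewrite !take_drop_catl ?take_drop_wpow ?size_wpow.
Qed.

Lemma factor_of_infix w y X : infix w y -> factor_of y X -> factor_of w X.
Proof.
case/infixP=> p [s ->] [k]; rewrite !size_cat !blockD => /eqP.
rewrite !eqseq_cat ?size_mkseq // => /and3P[_ /eqP def_w _].
by exists (k + size p).
Qed.

End Infixes.

(** * Counting factors; right special words *)

Lemma mem_factors (T : finType) (x : nat -> T) n w :
  w \in [seq val t | t <- enum [set t : n.-tuple T | `[< factor_of t x >]]] <->
  size w = n /\ factor_of w x.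
Proof.
split=> [/mapP[t] |[sz_w xw]].
  by rewrite mem_enum inE => /asboolP xt ->; rewrite size_tuple.
apply/mapP; exists (Tuple (introT eqP sz_w)) => //.
by rewrite mem_enum inE; apply/asboolP.
Qed.

Lemma complexity_ge (T : finType) (x : nat -> T) n (s : seq (seq T)) :
  uniq s -> (forall w, w \in s -> size w = n /\ factor_of w x) ->
  size s <= complexity x n.
Proof.
move=> Us xs; rewrite /complexity cardE -(size_map val).
by apply: uniq_leq_size => // w /xs /mem_factors.
Qed.

Lemma complexity_le (T : finType) (x : nat -> T) n (s : seq (seq T)) :
  (forall w, size w = n -> factor_of w x -> w \in s) ->
  complexity x n <= size s.
Proof.
move=> xs; rewrite /complexity cardE -(size_map val).
apply: uniq_leq_size.
  by rewrite map_inj_uniq ?enum_uniq //; apply: val_inj.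
by move=> w /mem_factors[]; apply: xs.
Qed.

Definition right_special (x : nat -> bool) (w : seq bool) :=
  forall b, factor_of (rcons w b) x.

Lemma right_special_suffix x w w' :
  suffix w w' -> right_special x w' -> right_special x w.
Proof.
case/suffixP=> p -> xw b; apply: factor_of_infix (xw b).
by rewrite rcons_cat; apply: suffix_infix; apply: suffix_suffix.
Qed.

Lemma complexityS_ge x n w1 w2 : size w1 = n -> size w2 = n -> w1 != w2 ->
  right_special x w1 -> right_special x w2 ->
  complexity x n + 2 <= complexity x n.+1.
Proof.
move=> sz1 sz2 neq12 xw1 xw2.
pose s :=
  [seq val t | t <- enum [set t : n.-tuple bool | `[< factor_of t x >]]].
(* [ext] extends every factor of length n to one of length n.+1, choosing the
   letter true where possible; hence the two words [rcons w_i false] are new. *)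
pose ext (w : seq bool) := rcons w `[< factor_of (rcons w true) x >].
have <- : size (map ext s ++ [:: rcons w1 false; rcons w2 false]) =
    complexity x n + 2.
  by rewrite size_cat !size_map -cardE.
have ext_inj w w' b b' : rcons w b = rcons w' b' -> w = w' /\ b = b' :> bool.
  by move/eqP; rewrite eqseq_rcons => /andP[/eqP-> /eqP->].
have ext_false w : right_special x w -> rcons w false \notin map ext s.
  move=> xw; apply/mapP=> -[w' _ /ext_inj[<- /esym/asboolP[]]].
  exact: xw.
apply: complexity_ge => [|w].
  rewrite cat_uniq map_inj_uniq; last by move=> w w' /ext_inj[].
  rewrite map_inj_uniq ?enum_uniq; last exact: val_inj.
  rewrite /= !negb_or !ext_false //= !andbT.
  by apply: contra neq12 => /eqP/ext_inj[->].
rewrite mem_cat => /orP[/mapP[w' /mem_factors[sz_w' xw'] ->]|].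
  split; first by rewrite size_rcons sz_w'.
  rewrite /ext; case: asboolP => [//|nxw].
  case: xw' => k def_w'; exists k.
  rewrite size_rcons blockS def_w'; case def_b: (x _) => //.
  by case: nxw; exists k; rewrite size_rcons blockS def_w' def_b.
by rewrite !inE => /orP[] /eqP->; rewrite size_rcons ?sz1 ?sz2; split.
Qed.

(** The suffixes of length [n] reach past [t] to the differing letters, so they are distinct; being
    right special passes to suffixes. *)
Lemma complexityS_ge_suffix x n t w1 w2 :
  suffix (false :: t) w1 -> suffix (true :: t) w2 ->
  right_special x w1 -> right_special x w2 ->
  size t < n -> n <= size w1 -> n <= size w2 ->
  complexity x n + 2 <= complexity x n.+1.
Proof.
move=> /suffixP[p1 ->] /suffixP[p2 ->] xw1 xw2 lt_tn le_n1 le_n2.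
have sz w : n <= size w -> size (drop (size w - n) w) = n.
  by move=> ?; rewrite size_drop; lia.
pose tl p b := drop (size (p ++ b :: t) - n) (p ++ b :: t).
apply: (@complexityS_ge x n (tl p1 false) (tl p2 true)); rewrite ?sz //.
- rewrite /tl !drop_catl ?size_cat /=; try lia.
  apply/eqP => /eqP; rewrite eqseq_cat.
    by rewrite eqseq_cons andbF.
  by rewrite !size_drop ?size_cat /=; rewrite !size_cat /= in le_n1 le_n2; lia.
- by apply: right_special_suffix xw1; exact: suffix_drop.
by apply: right_special_suffix xw2; exact: suffix_drop.
Qed.

(** * Lengths of u_i and v_i in terms of [X_ i] *)

Definition X_ (i : nat) : nat := 2 ^ (2 * 2 ^ i).

Lemma X_S i : X_ i.+1 = X_ i ^ 2.
Proof. by rewrite /X_ -expnM expnS; congr (2 ^ _); lia. Qed.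

Lemma X_ge4 i : 4 <= X_ i.
Proof. by rewrite /X_ expnM -[leqLHS]expn1 leq_exp2l // expn_gt0. Qed.

Lemma l_E i : l_ i = 16 * X_ i.
Proof. by rewrite /l_ expnD mulnC. Qed.

Lemma m_E i : m_ i = X_ i ^ 4.
Proof. by rewrite /m_ /X_ -expnM; congr (2 ^ _); lia. Qed.

Lemma n_E i : n_ i = X_ i ^ 5.
Proof. by rewrite /n_ /X_ -expnM; congr (2 ^ _); lia. Qed.

Lemma size_u_S i :
  size (u_ i.+1) = m_ i * size (u_ i) + l_ i * size (v_ i).
Proof. by rewrite u_S size_cat !size_wpow. Qed.

Lemma size_v_S i :
  size (v_ i.+1) = m_ i * size (u_ i) + n_ i * size (v_ i).
Proof. by rewrite v_S size_cat !size_wpow. Qed.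

(** The coefficient 16 in [l_E] makes the ratio exact: with X = [X_ i], both sides at i + 1 become
    (X^6 + 4 X^4) |u_i|. *)
Lemma size_uv i : 4 * size (v_ i) = X_ i * size (u_ i).
Proof.
elim: i => // i IHi; rewrite size_u_S size_v_S X_S l_E m_E n_E.
rewrite mulnDr mulnDr [4 * (X_ i ^ 5 * _)]mulnCA IHi.
rewrite (_ : X_ i ^ 2 * (16 * X_ i * _) = 4 * X_ i ^ 3 * (4 * size (v_ i))).
  by rewrite IHi; ring.
by ring.
Qed.

Lemma size_u_gt0 i : 0 < size (u_ i).
Proof. exact: leq_ltn_trans (size_u_gt i). Qed.

Lemma size_u_le_v i : size (u_ i) <= size (v_ i).
Proof.
rewrite -(@leq_pmul2l 4) // size_uv leq_mul2r X_ge4 orbT //.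
Qed.

Lemma X_exp_ge i a : 4 * X_ i ^ a <= X_ i ^ a.+1.
Proof. by rewrite expnS leq_mul2r X_ge4 orbT. Qed.

Lemma m_gt1 i : 1 < m_ i.
Proof.
rewrite m_E; have := X_ge4 i; have := X_exp_ge i 1.
by have := X_exp_ge i 2; have := X_exp_ge i 3; rewrite expn1; lia.
Qed.

Lemma l_gt0 i : 0 < l_ i.
Proof. by rewrite expn_gt0. Qed.

Lemma l_lt_n i : (l_ i).+1 < n_ i.
Proof.
rewrite l_E n_E; have := X_ge4 i.
have := X_exp_ge i 1; have := X_exp_ge i 2; have := X_exp_ge i 3.
by have := X_exp_ge i 4; rewrite expn1; lia.
Qed.

Lemma size_lV i : l_ i * size (v_ i) = 4 * X_ i ^ 2 * size (u_ i).
Proof.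
rewrite l_E (_ : 16 * X_ i * _ = 4 * X_ i * (4 * size (v_ i))).
  by rewrite size_uv; ring.
by ring.
Qed.

(** Gives |S_i v_i^(l_i) P_i| <= |A_i|, so that the two ranges of the lower bound leave no gap. *)
Lemma lV_U_le_mU i :
  l_ i * size (v_ i) + size (u_ i) <= m_ i * size (u_ i).
Proof.
rewrite size_lV m_E addnC -mulSn leq_mul2r; apply/orP; right.
have := X_ge4 i; have := X_exp_ge i 1.
by have := X_exp_ge i 2; have := X_exp_ge i 3; rewrite expn1; lia.
Qed.

(** Amounts to |S_(i+1) P_(i+1)| <= |B_i|; in units of |u_i| / 4 it reads 4 X^4 + 32 X^2 + X <=
    X^6. *)
Lemma mU_lV_V_le_nV i :
  m_ i * size (u_ i) + 2 * (l_ i * size (v_ i)) + size (v_ i)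
    <= n_ i * size (v_ i).
Proof.
rewrite size_lV m_E n_E -(@leq_pmul2l 4) //.
rewrite (_ : 4 * (_ + _) =
  (4 * X_ i ^ 4 + 32 * X_ i ^ 2) * size (u_ i) + 4 * size (v_ i)); last by ring.
rewrite [4 * (X_ i ^ 5 * _)]mulnCA size_uv -mulnDl.
rewrite mulnA -expnSr leq_mul2r; apply/orP; right.
have := X_ge4 i; have := X_exp_ge i 1; have := X_exp_ge i 2.
have := X_exp_ge i 3; have := X_exp_ge i 4; have := X_exp_ge i 5.
by rewrite expn1; lia.
Qed.

(** * The common prefixes P_i and suffixes S_i *)

Fixpoint lcp_uv (i : nat) : seq bool :=
  if i is j.+1 then u_ i ++ lcp_uv j else [::].

Fixpoint lcs_uv (i : nat) : seq bool :=
  if i is j.+1 then lcs_uv j ++ wpow (v_ j) (l_ j) else [::].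

Lemma lcp_uvS i : lcp_uv i.+1 = u_ i.+1 ++ lcp_uv i.
Proof. by []. Qed.

Lemma lcs_uvS i : lcs_uv i.+1 = lcs_uv i ++ wpow (v_ i) (l_ i).
Proof. by []. Qed.

Lemma prefix_uu i x : x \in [:: u_ i.+1; v_ i.+1] -> prefix (u_ i ++ u_ i) x.
Proof.
rewrite !inE u_S v_S; have := m_gt1 i; case: (m_ i) => [//|[//|m]] _.
by case/orP=> /eqP->; rewrite !wpowS -!catA [X in prefix _ X]catA prefix_prefix.
Qed.

(** For i > 0, P_i 0 is longer than u_i, hence the continuation [x]. In the induction [x] starts
    with u_i u_i, which starts with P_i 0. *)
Lemma prefix_lcp_uv_u i x : x \in [:: u_ i; v_ i] ->
  prefix (rcons (lcp_uv i) false) (u_ i ++ x).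
Proof.
elim: i x => [x _|i IHi x x_uv]; first exact: (prefix_prefix [:: false]).
have /prefixP[s ->] := prefix_uu x_uv.
rewrite lcp_uvS rcons_cat prefix_catr // eqxx -catA catA prefix_catl //.
by rewrite IHi ?mem_head.
Qed.

(** Since v_(i+1) = u_(i+1) v_i^(n_i - l_i) with a positive exponent, the induction hypothesis
    applies right after u_(i+1). *)
Lemma prefix_lcp_uv_v i : prefix (rcons (lcp_uv i) true) (v_ i).
Proof.
elim: i => [//|i IHi].
rewrite lcp_uvS rcons_cat v_S -(subnKC (ltnW (ltnW (l_lt_n i)))) wpowD catA.
rewrite -u_S.
rewrite prefix_catr // eqxx /=.
have : 0 < n_ i - l_ i by have := l_lt_n i; lia.
by case: (n_ i - l_ i) => // d _; rewrite wpowS prefix_catl.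
Qed.

(** Before the final v_i^(l_i), u_(i+1) has u_i whereas v_(i+1) still has v_i, so the distinguishing
    letters are inherited. *)
Lemma suffix_lcs_uv_u i : suffix (false :: lcs_uv i) (u_ i).
Proof.
elim: i => [//|i IHi]; rewrite lcs_uvS u_S -cat_cons suffix_catl // eqxx /=.
have := ltnW (m_gt1 i); case: (m_ i) => // m _.
by rewrite wpowSr suffix_catr.
Qed.

Lemma suffix_lcs_uv_v i : suffix (true :: lcs_uv i) (v_ i).
Proof.
elim: i => [//|i IHi]; rewrite lcs_uvS v_S.
rewrite -(subnK (ltnW (ltnW (l_lt_n i)))) wpowD catA.
rewrite -cat_cons suffix_catl // eqxx suffix_catr //.
have : 0 < n_ i - l_ i by have := l_lt_n i; lia.
by case: (n_ i - l_ i) => // d _; rewrite wpowSr suffix_catr.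
Qed.

(** * Concatenations of words from a given list *)

Section Blocks.
Variable T : eqType.
Implicit Types w x : seq T.

Definition concat_of (B : seq (seq T)) x :=
  exists2 ss, {subset ss <= B} & x = flatten ss.

Lemma concat_of_cat B x y :
  concat_of B x -> concat_of B y -> concat_of B (x ++ y).
Proof.
move=> [s sB ->] [t tB ->]; exists (s ++ t); last by rewrite flatten_cat.
by move=> z; rewrite mem_cat => /orP[/sB|/tB].
Qed.

Lemma concat_of_wpow B x a : concat_of B x -> concat_of B (wpow x a).
Proof.
move=> Bx; elim: a => [|a IHa]; first by exists [::].
by rewrite wpowS; apply: concat_of_cat.
Qed.

Lemma concat_of_mem (B : seq (seq T)) x : x \in B -> concat_of B x.
Proof.
move=> Bx; exists [:: x]; first by move=> y; rewrite inE => /eqP->.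
by rewrite -[RHS]/(x ++ [::]) cats0.
Qed.

End Blocks.

Lemma concat_of_uv i j : i <= j ->
  concat_of [:: u_ i; v_ i] (u_ j) /\ concat_of [:: u_ i; v_ i] (v_ j).
Proof.
move=> /subnK<-; elim: (j - i) => [|d [IHu IHv]].
  by split; apply: concat_of_mem; rewrite !inE eqxx ?orbT.
by rewrite addSn u_S v_S; split; apply: concat_of_cat; apply: concat_of_wpow.
Qed.

(** * Factors and right special words of the limit word *)

Section LimitWord.
Variable u : nat -> bool.
Hypothesis hu : forall i, prefix_of (u_ i) u.

Lemma factor_of_u i : factor_of (u_ i) u.
Proof. by exists 0; apply: hu. Qed.

Lemma factor_of_infix_u w :
  factor_of w u -> exists i, forall j, i <= j -> infix w (u_ j).
Proof.
case=> k def_w; exists (k + size w) => j le_j; apply/infixP.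
have := hu j; rewrite /prefix_of.
have lt_sz := size_u_gt j.
rewrite (_ : size (u_ j) = k + size w + (size (u_ j) - (k + size w))); last lia.
rewrite !blockD def_w -catA => <-; do 2!eexists; reflexivity.
Qed.

Lemma factor_of_uv i : factor_of (u_ i ++ v_ i) u.
Proof.
apply: factor_of_infix (factor_of_u i.+1); rewrite u_S.
move: (ltnW (m_gt1 i)) (l_gt0 i); case: (m_ i) (l_ i) => [//|m] [//|l] _ _.
apply/infixP; exists (wpow (u_ i) m), (wpow (v_ i) l).
by rewrite wpowSr wpowS -!catA.
Qed.

Lemma factor_of_vu i : factor_of (v_ i ++ u_ i) u.
Proof.
apply: factor_of_infix (factor_of_u i.+2).
have /prefixP[s ->] : prefix (u_ i.+1 ++ u_ i.+1) (u_ i.+2).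
  by apply: prefix_uu; rewrite mem_head.
rewrite infix_catr // u_S.
move: (ltnW (m_gt1 i)) (l_gt0 i); case: (m_ i) (l_ i) => [//|m] [//|l] _ _.
apply/infixP; exists (wpow (u_ i) m.+1 ++ wpow (v_ i) l).
exists (wpow (u_ i) m ++ wpow (v_ i) l.+1).
by rewrite {1}wpowSr (wpowSr (v_ i) l) [in RHS]wpowSr (wpowS (u_ i) m) -!catA.
Qed.

(** S_i y P_i 0 lies in v_i y u_i x for x either u_i or v_i, whence the disjunction, and S_i y P_i 1
    lies in u_i y v_i. *)
Lemma right_special_uv i y :
  factor_of (v_ i ++ y ++ u_ i ++ u_ i) u \/
    factor_of (v_ i ++ y ++ u_ i ++ v_ i) u ->
  factor_of (u_ i ++ y ++ v_ i) u ->
  right_special u (lcs_uv i ++ y ++ lcp_uv i).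
Proof.
move=> vyu uyv b; rewrite !rcons_cat.
have Su := catl_suffix (s := [:: false]) (suffix_lcs_uv_u i).
have Sv := catl_suffix (s := [:: true]) (suffix_lcs_uv_v i).
case: b.
  apply: factor_of_infix uyv; apply: infix_cat_suffix_prefix => //.
  exact: prefix_lcp_uv_v.
by case: vyu; apply: factor_of_infix; apply: infix_cat_suffix_prefix => //;
  apply: prefix_lcp_uv_u; rewrite !inE eqxx ?orbT.
Qed.

(** v_i u_i^(m_i) v_i straddles u_(i+1) v_(i+1), and u_i^(m_i) v_i occurs in u_(i+1). *)
Lemma right_special_u i :
  right_special u (lcs_uv i ++ wpow (u_ i) (m_ i).-1 ++ lcp_uv i).
Proof.
apply: right_special_uv; [right|].
  apply: factor_of_infix (factor_of_uv i.+1); rewrite u_S v_S.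
  move: (ltnW (m_gt1 i)) (l_gt0 i) (ltnW (l_lt_n i)).
  case: (m_ i) (l_ i) (n_ i) => [//|m] [//|l] [//|n] _ _ _.
  apply/infixP; exists (wpow (u_ i) m.+1 ++ wpow (v_ i) l), (wpow (v_ i) n).
  by rewrite (wpowSr (u_ i)) (wpowSr (v_ i)) (wpowS (v_ i)) -!catA.
apply: factor_of_infix (factor_of_u i.+1); rewrite u_S.
move: (ltnW (m_gt1 i)) (l_gt0 i); case: (m_ i) (l_ i) => [//|m] [//|l] _ _.
by apply/infixP; exists [::], (wpow (v_ i) l); rewrite !wpowS -!catA.
Qed.

(** v_i^(n_i) u_i u_i straddles v_(i+1) u_(i+1), and u_i v_i^(n_i) occurs in v_(i+1). *)
Lemma right_special_v i :
  right_special u (lcs_uv i ++ wpow (v_ i) (n_ i).-1 ++ lcp_uv i).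
Proof.
apply: right_special_uv; [left|].
  apply: factor_of_infix (factor_of_vu i.+1); rewrite u_S v_S.
  move: (m_gt1 i) (ltnW (l_lt_n i)).
  case: (m_ i) (n_ i) => [//|[//|m]] [//|n] _ _.
  apply/infixP; exists (wpow (u_ i) m.+2).
  exists (wpow (u_ i) m ++ wpow (v_ i) (l_ i)).
  by rewrite !(wpowS (u_ i)) (wpowS (v_ i)) -!catA.
apply: factor_of_infix (factor_of_uv i.+1); rewrite v_S infix_catl //.
move: (ltnW (m_gt1 i)) (ltnW (l_lt_n i)).
case: (m_ i) (n_ i) => [//|m] [//|n] _ _.
by apply/infixP; exists (wpow (u_ i) m), [::]; rewrite !wpowSr cats0 -!catA.
Qed.

(** * The lower bound *)

Lemma complexityS_ge2 n : 0 < n -> complexity u n + 2 <= complexity u n.+1.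
Proof.
move=> n_gt0.
(* [a i] is |S_i P_i|; as it starts at 0 and is unbounded, the intervals between consecutive values
   cover all positive lengths. *)
pose a i := size (lcp_uv i) + size (lcs_uv i).
have aS i : a i.+1 = m_ i * size (u_ i) + 2 * (l_ i * size (v_ i)) + a i.
  by rewrite /a lcp_uvS lcs_uvS size_cat size_u_S size_cat size_wpow; lia.
have [i /andP[lt_in le_ni]] : exists i, a i < n <= a i.+1.
  have lt_n : n <= a n.
    rewrite /a; case: (n) => // j; rewrite lcp_uvS size_cat.
    by have := size_u_gt j.+1; lia.
  elim: {2}n lt_n => [|j IHj] le_nj.
    by have : false := leq_trans n_gt0 le_nj.
  by case: (leqP n (a j)) => [/IHj //|lt_jn]; exists j; rewrite lt_jn.
have m_gt0 : 0 < (m_ i).-1 by have := m_gt1 i; lia.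
have n'_gt : l_ i < (n_ i).-1 by have := l_lt_n i; lia.
have szA j : size (lcs_uv j ++ wpow (u_ j) (m_ j).-1 ++ lcp_uv j) =
    m_ j * size (u_ j) - size (u_ j) + a j.
  by rewrite !size_cat size_wpow -subn1 mulnBl mul1n /a; lia.
have szB j : size (lcs_uv j ++ wpow (v_ j) (n_ j).-1 ++ lcp_uv j) =
    n_ j * size (v_ j) - size (v_ j) + a j.
  by rewrite !size_cat size_wpow -subn1 mulnBl mul1n /a; lia.
have suffB k : k < (n_ i).-1 ->
    suffix (true :: (lcs_uv i ++ wpow (v_ i) k ++ lcp_uv i))
    (lcs_uv i ++ wpow (v_ i) (n_ i).-1 ++ lcp_uv i).
  move=> lt_k; rewrite -(subnK lt_k) addnS -addSn wpowD wpowSr -!catA.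
  do 2!apply: suffix_catr.
  by rewrite -cat_cons suffix_catl // eqxx suffix_lcs_uv_v.
have leV := mU_lV_V_le_nV i; have leUV := size_u_le_v i.
have leU := lV_U_le_mU i.
(* Up to length |A_i| the pair A_i, B_i serves; beyond it, B_i and A_(i+1). *)
have [le_nA|lt_An] := leqP n (m_ i * size (u_ i) - size (u_ i) + a i).
  apply: (complexityS_ge_suffix (t := lcs_uv i ++ lcp_uv i) _ (suffB 0 _)
     (right_special_u i) (right_special_v i)) => //.
  - case: (_.-1) m_gt0 => // m _; rewrite wpowSr -!catA.
    do 2!apply: suffix_catr.
    by rewrite -cat_cons suffix_catl // eqxx suffix_lcs_uv_u.
  - lia.
  - by rewrite size_cat /a addnC in lt_in *.
  - by rewrite szA.
  by rewrite szB; lia.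
have lt_n : size (lcs_uv i ++ wpow (v_ i) (l_ i) ++ lcp_uv i) < n.
  by rewrite !size_cat size_wpow; rewrite /a in lt_An; lia.
apply: (complexityS_ge_suffix _ (suffB _ n'_gt) 
     (right_special_u i.+1) (right_special_v i)) => //.
- rewrite lcp_uvS; do 2!apply: suffix_catr; rewrite u_S.
  have := ltnW (m_gt1 i); case: (m_ i) => // m _.
  rewrite wpowSr -!catA suffix_catr // -cat_cons suffix_catl // eqxx.
  exact: suffix_lcs_uv_u.
- rewrite szA; apply: leq_trans le_ni _; lia.
by rewrite szB; move: le_ni; rewrite aS; lia.
Qed.

Lemma complexity_ge2 n : 2 * n <= complexity u n.
Proof.
elim: n => // -[_|n IHn].
  (* The increment is known only from length 1 on, so the two letters start the induction. *)
  apply: (@complexity_ge _ u 1 [:: u_ 0; v_ 0]) => // w.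
  rewrite !inE => /orP[] /eqP->; split=> //.
    by apply: factor_of_infix (factor_of_uv 0); apply: prefix_infix.
  by apply: factor_of_infix (factor_of_uv 0); rewrite infix_catl ?infix_refl.
by have := complexityS_ge2 (ltn0Sn n); lia.
Qed.

(** * The upper bound at lengths l_i |v_i| *)

Lemma factor_short i w : factor_of w u -> size w = l_ i * size (v_ i) ->
  infix w (wpow (u_ i) (m_ i) ++ wpow (v_ i) (n_ i)) \/
  infix w (wpow (v_ i) (n_ i) ++ wpow (u_ i) (m_ i)).
Proof.
move=> /factor_of_infix_u[j uw] sz_w.
have w_gt0 : 0 < size w by rewrite sz_w muln_gt0 l_gt0 size_v_gt0.
have le_wu : size w <= m_ i * size (u_ i) by have := lV_U_le_mU i; lia.
have [[ss ss_uv def_u] _] := concat_of_uv (leq_maxl i.+1 j).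
have := uw _ (leq_maxr i.+1 j); rewrite def_u.
have uvE y : y \in [:: u_ i.+1; v_ i.+1] -> exists2 c,
    y = wpow (u_ i) (m_ i) ++ wpow (v_ i) c & l_ i <= c <= n_ i.
  have := l_lt_n i => lt_ln.
  by rewrite !inE => /orP[] /eqP->; [exists (l_ i)|exists (n_ i)] => //; lia.
case/(infix_flatten w_gt0) => [y|y [z [/ss_uv y_uv /ss_uv z_uv]]].
  by move=> /ss_uv/uvE[c -> _]; rewrite size_cat !size_wpow /=; lia.
have uv_n c : c <= n_ i -> infix w (wpow (u_ i) (m_ i) ++ wpow (v_ i) c) ->
    infix w (wpow (u_ i) (m_ i) ++ wpow (v_ i) (n_ i)).
  by move=> /subnKC<-; rewrite wpowD catA; apply: infix_catr.
have [c -> /andP[le_lc le_cn]] := uvE _ y_uv.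
have [d -> /andP[_ le_dn]] := uvE _ z_uv.
(* In u_i^(m_i) v_i^c u_i^(m_i) v_i^d both middle runs are at least as long as [w], so [w] meets at
   most two adjacent runs. *)
rewrite -catA => /infix_cat3[||].
- by rewrite size_wpow sz_w leq_mul2r le_lc orbT.
- by left; apply: uv_n le_cn _.
case/infix_cat3; [by rewrite size_wpow| |by left; apply: uv_n le_dn _].
right; rewrite -(subnK le_cn) wpowD -catA; exact: infix_catl.
Qed.

Lemma complexity_le_lV i (N := l_ i * size (v_ i)) :
  complexity u N <= 2 * N + 4 * size (v_ i).
Proof.
have szT x y a b :
    size (@transition_windows bool x y a b N) = N + size x + size y.
  by rewrite size_map size_iota.
pose s := transition_windows (u_ i) (v_ i) (m_ i) (n_ i) N ++
          transition_windows (v_ i) (u_ i) (n_ i) (m_ i) N.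
have [u_gt0 v_gt0] := (size_u_gt0 i, size_v_gt0 i).
apply: (@leq_trans (size s)).
  apply: complexity_le => w sz_w /factor_short => /(_ i sz_w) uvw.
  by rewrite mem_cat /s -sz_w; apply/orP; case: uvw; [left|right];
    apply: mem_transition_windows.
by rewrite size_cat !szT; have := size_u_le_v i; rewrite /N /=; lia.
Qed.

End LimitWord.

(** * The limit inferior *)

Import Order.TTheory GRing.Theory Num.Theory.

(** The infima of the tails are eventually constant, equal to [l]. *)
Lemma limn_einf_eq (R : realType) (f : nat -> \bar R) (l : R) :
  (\forall n \near \oo, l%:E <= f n)%classic%E ->
  (forall e : R, (0 < e)%R ->
    forall n, exists2 k, n <= k & (f k <= (l + e)%R%:E)%E) ->
  limn_einf f = l%:E.
Proof.
move=> [N _ fl] flE; rewrite limn_einf_lim; apply: cvg_lim => //.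
apply: cvg_near_cst; exists N => // n /= le_Nn; apply/eqP.
rewrite eq_le; apply/andP; split.
  apply/lee_addgt0Pr => e e_gt0; have [k le_nk lfk] := flE e e_gt0 n.
  by apply: le_trans lfk; apply: ereal_inf_lbound; exists k.
apply: le_ereal_inf_tmp => _ [k /= le_nk <-].
by apply: fl; apply: leq_trans le_nk.
Qed.

Lemma ltn_l i : i < l_ i.
Proof.
have lt_i := ltn_expl i (ltnSn 1).
by apply: (leq_trans lt_i); rewrite leq_exp2l //; lia.
Qed.

Theorem theorem5p4 (R : realType) (u : nat -> bool)
    (hu : forall i : nat, prefix_of (u_ i) u) :
  limn_einf (fun n : nat => ((complexity u n)%:R / n%:R : R)%R%:E) = (2%:R : R)%R%:E.
Proof.
apply: limn_einf_eq => [|e e_gt0 n].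
  (* At length 0 the quotient is 0 by the convention on division, so the bound starts at 1. *)
  exists 1 => // n /= n_gt0; rewrite lee_fin ler_pdivlMr ?ltr0n //.
  by rewrite -natrM ler_nat complexity_ge2.
(* Since l_k > k, the length l_k |v_k| is at least [n] and l_k > 4 / e, so 4 |v_k| is at most e l_k
   |v_k|. *)
pose k := (n + Num.truncn (4 / e)%R)%N.
have lt_kl := ltn_l k.
have v_gt0 := size_v_gt0 k.
exists (l_ k * size (v_ k))%N.
  rewrite (leq_trans _ (leq_pmulr _ v_gt0)) // (leq_trans _ (ltnW lt_kl)) //.
  exact: leq_addr.
rewrite lee_fin ler_pdivrMr ?ltr0n ?muln_gt0 ?l_gt0 //.
apply: (@le_trans _ _ (2 * (l_ k * size (v_ k)) + 4 * size (v_ k))%:R%R).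
  by rewrite ler_nat complexity_le_lV.
rewrite natrD mulrDl natrM lerD2l !natrM mulrA ler_wpM2r //.
rewrite -ler_pdivrMl // mulrC.
apply: ltW; apply: lt_le_trans (truncnS_gt _) _.
by rewrite ler_nat (leq_trans _ lt_kl) // ltnS leq_addl.
Qed.
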